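(* Let $(a(n))_{n\ge 1}$ be the Binary Enots Wolley sequence and let $v$ be a non-negative integer. If $n$ is the least positive integer such that $v\in\operatorname{supp}(a(n))$, then the term $a(n)$ has a binary weight of $2$, i.e. $s_2(a(n))=2$.
   Context: For a positive integer $k$, $\operatorname{supp}(k)$ denotes the set of positions of the $1$s in the binary expansion of $k$ (positions are numbered from $0$, so $\operatorname{supp}(15)=\{0,1,2,3\}$ and $\operatorname{supp}(1)=\{0\}$), and $s_2(k)$ denotes the binary weight of $k$, i.e. the number of $1$s in its binary expansion. The Binary Enots Wolley sequence $(a(n))_{n\ge1}$ is the lexicographically earliest infinite sequence of distinct positive integers with the property that, whenever the earlier terms referred to exist, the binary expansions of $a(n)$ and $a(n-1)$ have a $1$ in the same position ($\operatorname{supp}(a(n))\cap\operatorname{supp}(a(n-1))\ne\emptyset$), but the positions of the $1$s in the binary expansions of $a(n)$ and $a(n-2)$ are disjoint ($\operatorname{supp}(a(n))\cap\operatorname{supp}(a(n-2))=\emptyset$). The sequence begins $1,3,6,12,9,17,18,\dots$.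
   Formalization: The case v = 0 is excluded (v is taken to be a positive integer), because a(1) = 1 makes n = 1 the least index with 0 in supp(a(n)), and s_2(a(1)) = 1 rather than 2. *)

(* Defs.v *)
(* MathComp world *)
From mathcomp Require Import all_boot finmap.

Set Implicit Arguments.
Unset Strict Implicit.
Unset Printing Implicit Defensive.

Local Open Scope fset_scope.

(* The bound [iota 0 k] loses nothing: a 1 in position [i] of [k] forces
   [i < 2 ^ i <= k]; see [in_supp]. *)
Definition supp (k : nat) : {fset nat} :=
  [fset i in iota 0 k | odd (k %/ 2 ^ i)].

Lemma in_supp (k i : nat) : (i \in supp k) = odd (k %/ 2 ^ i).
Proof.
rewrite !inE /= mem_iota add0n /=.
case: ltnP => //= le_ki; rewrite divn_small //.
by apply: leq_ltn_trans le_ki _; apply: ltn_expl.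
Qed.

Definition s2 (k : nat) : nat := #|` supp k|.

(* Sequences are indexed from 1: the value [a 0] is a dummy, never
   constrained and never compared. *)
Record enots_wolley (a : nat -> nat) : Prop := EnotsWolley {
  ew_pos : forall n, 0 < n -> 0 < a n;
  ew_distinct : forall m n, 0 < m -> 0 < n -> a m = a n -> m = n;
  ew_meet : forall n, 1 < n -> supp (a n) `&` supp (a (n - 1)) <> fset0;
  ew_disjoint : forall n, 2 < n -> supp (a n) `&` supp (a (n - 2)) = fset0
}.

Definition seq_eq (a b : nat -> nat) : Prop := forall n, 0 < n -> a n = b n.

Definition lex_lt (a b : nat -> nat) : Prop :=
  exists n, [/\ 0 < n, forall m, 0 < m < n -> a m = b m & a n < b n].

Definition binary_enots_wolley (a : nat -> nat) : Prop :=
  enots_wolley a /\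
  forall b, enots_wolley b -> seq_eq a b \/ lex_lt a b.

(* Main.v *)
(** If [v] first occurs in [a n], let [b] be a common position of [a n] and
    [a (n - 1)]. Replacing [a n] by the number [2 ^ b + 2 ^ v], which is at most
    [a n], breaks none of the conditions, and because [v] does not occur in
    [a (n - 1)] the new prefix extends to an infinite admissible sequence, by
    chaining fresh positions: [{v, N}, {N, N + 1}, {N + 1, N + 2}, ...].
    Lexicographic minimality then forces [a n = 2 ^ b + 2 ^ v]. *)
Require Import Defs.
From mathcomp Require Import all_boot finmap.
From mathcomp Require Import zify.

Set Implicit Arguments.
Unset Strict Implicit.
Unset Printing Implicit Defensive.

Local Open Scope fset_scope.
Local Open Scope nat_scope.

Lemma supp_double_half k i : (i.+1 \in supp k) = (i \in supp k./2).
Proof. by rewrite !in_supp expnS divnMA divn2. Qed.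

Lemma supp0 : supp 0 = fset0.
Proof. by apply/fsetP => i; rewrite in_supp div0n inE. Qed.

Lemma supp_lt k i : i \in supp k -> i < k.
Proof. by rewrite !inE /= mem_iota => /andP[]. Qed.

Lemma supp_leq k i : i \in supp k -> 2 ^ i <= k.
Proof. by rewrite in_supp; case: leqP => // lt_k; rewrite divn_small. Qed.

(** A free position takes the new 1 without a carry; the induction strips the lowest bit from [i],
    [j] and [k] together. *)
Lemma supp_addX k i : i \notin supp k -> supp (k + 2 ^ i) = i |` supp k.
Proof.
move=> nik; apply/fsetP => j; rewrite in_fset1U.
elim: i j k nik => [|i IHi] [|j] k nik.
- by rewrite in_supp expn0 divn1 oddD addbT; move: nik; rewrite in_supp divn1.
- rewrite !supp_double_half /= addn1 /= uphalf_half.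
  by move: nik; rewrite in_supp divn1 => /negbTE->.
- by rewrite !in_supp expn0 !divn1 oddD oddX addbF.
- rewrite !supp_double_half eqSS -IHi; last by rewrite -supp_double_half.
  by rewrite halfD oddX andbF expnS mul2n doubleK.
Qed.

Lemma supp_subX k i : i \in supp k -> i \notin supp (k - 2 ^ i).
Proof.
move=> ik; move: (ik); rewrite !in_supp -{1}(subnK (supp_leq ik)).
by rewrite divnDr // divnn expn_gt0 addn1.
Qed.

Lemma supp_pair i j : i != j -> supp (2 ^ i + 2 ^ j) = [fset i; j].
Proof.
have supp1 : supp (2 ^ i) = [fset i] by rewrite -[2 ^ i]add0n supp_addX supp0 ?fsetU0.
by move=> neq_ij; rewrite supp_addX supp1 1?fsetUC // inE eq_sym.
Qed.

(** Removing [2 ^ i] from [k] leaves the 1 at [j] in place, so the remainder is still at least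
    [2 ^ j]. *)
Lemma supp_pair_leq i j k :
  i != j -> i \in supp k -> j \in supp k -> 2 ^ i + 2 ^ j <= k.
Proof.
move=> neq_ij ik jk; have := jk.
rewrite -{1}(subnK (supp_leq ik)) (supp_addX (supp_subX ik)) in_fset1U.
rewrite eq_sym (negbTE neq_ij) /= => /supp_leq.
by rewrite leq_subRL // supp_leq.
Qed.

Lemma fsetI_neq0 (A B : {fset nat}) x : x \in A -> x \in B -> A `&` B <> fset0.
Proof. by move=> xA xB eq0; have := in_fset0 x; rewrite -eq0 inE xA xB. Qed.

Lemma fsetI_eq0 (A B : {fset nat}) :
  (forall x, x \in A -> x \in B -> False) -> A `&` B = fset0.
Proof.
move=> AB; apply/fsetP => x; rewrite !inE; apply/negbTE/andP => -[].
exact: AB.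
Qed.

Section Extension.

Variables (p : nat -> nat) (n c : nat).
Hypothesis n_gt0 : 0 < n.
Hypothesis p_pos : forall m, 0 < m <= n -> 0 < p m.
Hypothesis p_inj : forall l m, 0 < l <= n -> 0 < m <= n -> p l = p m -> l = m.
Hypothesis p_meet :
  forall m, 1 < m <= n -> supp (p m) `&` supp (p (m - 1)) <> fset0.
Hypothesis p_disjoint :
  forall m, 2 < m <= n -> supp (p m) `&` supp (p (m - 2)) = fset0.
Hypothesis c_last : c \in supp (p n).
Hypothesis c_fresh : 1 < n -> c \notin supp (p (n - 1)).

(** A strict bound on all positions in the prefix, since a position of [k] is below [k]. *)
Let N := \sum_(m < n.+1) p m.
(** The position linking a new term to its predecessor: [c] for the first new term, afterwards the
    top position of the term before. *)
Let low (m : nat) := if m == n.+1 then c else N + m.-1.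
Let ext (m : nat) := if m <= n then p m else 2 ^ (N + m) + 2 ^ low m.

Let ext_old m : m <= n -> ext m = p m.
Proof. by rewrite /ext => ->. Qed.

Let old_lt m i : m <= n -> i \in supp (p m) -> i < N.
Proof.
move=> le_mn /supp_lt lt_i; apply: leq_trans lt_i _.
by rewrite /N (bigD1 (inord m)) //= inordK // leq_addr.
Qed.

Let lowE m :
  n < m -> low m < N + m /\
    (m = n.+1 /\ low m = c \/ n.+1 < m /\ low m = N + m.-1).
Proof.
have := old_lt (leqnn n) c_last; rewrite /low; case: eqP; lia.
Qed.

Let ext_new m i : n < m -> (i \in supp (ext m)) = (i == N + m) || (i == low m).
Proof.
move=> lt_nm; rewrite /ext leqNgt lt_nm /= supp_pair ?inE //.
have [] := lowE lt_nm; lia.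
Qed.

(** The top position [N + m] of a new term lies in no earlier term. *)
Let ext_inj l m : 0 < l <= m -> ext l = ext m -> l = m.
Proof.
move=> /andP[l_gt0 le_lm]; have [le_mn|lt_nm] := leqP m n.
  by rewrite !ext_old ?(leq_trans le_lm) //; apply: p_inj; lia.
move=> eq_lm; have : N + m \in supp (ext l) by rewrite eq_lm ext_new // eqxx.
have [le_ln|lt_nl] := leqP l n; first by rewrite ext_old // => /(old_lt le_ln); lia.
by rewrite ext_new //; have [] := lowE lt_nl; lia.
Qed.

Lemma enots_wolley_extension :
  exists b, enots_wolley b /\ forall m, m <= n -> b m = p m.
Proof.
exists ext; split=> //; split.
- move=> m m_gt0; rewrite /ext; case: ifP => le_mn; first by rewrite p_pos ?m_gt0.
  by rewrite addn_gt0 expn_gt0.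
- move=> l m l_gt0 m_gt0; have [le_lm|/ltnW le_ml] := leqP l m.
    by apply: ext_inj; rewrite l_gt0.
  by move/esym/ext_inj => ->; rewrite ?m_gt0.
- move=> m m_gt1; have [le_mn|lt_nm] := leqP m n.
    by rewrite !ext_old; [apply: p_meet | ..]; lia.
  apply: (@fsetI_neq0 _ _ (low m)); first by rewrite ext_new // eqxx orbT.
  have [_ [[-> ->]|[lt1m ->]]] := lowE lt_nm.
    by rewrite subn1 /= ext_old.
  by rewrite ext_new ?subn1 ?eqxx //; lia.
- move=> m m_gt2; have [le_mn|lt_nm] := leqP m n.
    by rewrite !ext_old ?p_disjoint ?m_gt2 //; lia.
  apply: fsetI_eq0 => i; rewrite ext_new //.
  have [lt_low low_m] := lowE lt_nm.
  have [le_n|lt_n] := leqP (m - 2) n.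
    rewrite ext_old // => im i_old; have lt_iN := old_lt le_n i_old.
    (* The only position of a new term below [N] is [c], and only term [n.+1] has it; two places
       back stands [p (n - 1)], which avoids [c]. *)
    have [eq_m eq_i] : m = n.+1 /\ i = c by lia.
    have : 1 < n by lia.
    move/c_fresh/negP; apply; rewrite -eq_i.
    by have -> : n - 1 = m - 2 by lia.
  by rewrite ext_new //; have [] := lowE lt_n; lia.
Qed.

End Extension.

(* Position [c] of [y] guarantees that [y] is not a dead end. *)
Lemma binary_enots_wolley_leq (a : nat -> nat) (n y c : nat) :
  binary_enots_wolley a -> 0 < n ->
  (forall m, 0 < m < n -> a m <> y) ->
  (1 < n -> supp y `&` supp (a (n - 1)) <> fset0) ->
  (2 < n -> supp y `&` supp (a (n - 2)) = fset0) ->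
  c \in supp y -> (1 < n -> c \notin supp (a (n - 1))) ->
  a n <= y.
Proof.
move=> [[a_pos a_inj a_meet a_disj] a_min] n_gt0 y_new y_meet y_disj cy c_fresh.
pose p m := if m == n then y else a m.
have pE m : m < n -> p m = a m by rewrite /p => /ltn_eqF ->.
have pn : p n = y by rewrite /p eqxx.
have [||||||b [b_ew b_eq]] := @enots_wolley_extension p n c n_gt0.
- move=> m /andP[m_gt0 _]; rewrite /p; case: eqP => // _; last exact: a_pos.
  by have := supp_lt cy; lia.
- move=> l m /andP[l_gt0 le_ln] /andP[m_gt0 le_mn].
  rewrite /p; case: eqP => [->|neq_l]; case: eqP => [->|neq_m] //.
  + by move/esym/y_new; case; lia.
  + by move/y_new; case; lia.
  + exact: a_inj.
- move=> m /andP[m_gt1]; rewrite leq_eqVlt => /orP[/eqP eq_mn|lt_mn].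
    by rewrite eq_mn pn pE; [apply: y_meet | ]; lia.
  by rewrite !pE; [apply: a_meet | ..]; lia.
- move=> m /andP[m_gt2]; rewrite leq_eqVlt => /orP[/eqP eq_mn|lt_mn].
    by rewrite eq_mn pn pE ?y_disj -?eq_mn //; lia.
  by rewrite !pE ?a_disj //; lia.
- by rewrite pn.
- by move=> n_gt1; rewrite pE ?c_fresh //; lia.
have bn : b n = y by rewrite b_eq.
case: (a_min b b_ew) => [eq_ab|[m [m_gt0 eq_ab lt_ab]]].
  by rewrite eq_ab // bn.
(* The first difference cannot precede [n], where [b] copies [a]; if it comes after [n], then
   [a n = y], and at [n] itself [a n < y]. *)
have [lt_mn|lt_nm|eq_mn] := ltngtP m n.
- by move: lt_ab; rewrite b_eq ?pE ?ltnn // ltnW.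
- by rewrite eq_ab ?bn // n_gt0.
- by rewrite -bn -eq_mn ltnW.
Qed.

Theorem theorem2 (a : nat -> nat) (v n : nat)
    (ha : binary_enots_wolley a)
    (hv : 0 < v)
    (hn : 0 < n)
    (hvn : v \in supp (a n))
    (hmin : forall m : nat, 0 < m -> v \in supp (a m) -> n <= m) :
  s2 (a n) = 2.
Proof.
have v_new m : 0 < m < n -> v \notin supp (a m).
  by move=> /andP[m_gt0]; rewrite ltnNge; apply: contra; apply: hmin.
have [n_le1|n_gt1] := leqP n 1.
  (* The candidate 1, continued through position 0, gives [a 1 <= 1]; but [v < a 1] and [0 < v]. *)
  have /supp_lt := hvn.
  have : a n <= 1.
    by apply: (binary_enots_wolley_leq (c := 0) ha hn); rewrite ?in_supp //; lia.
  lia.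
have v_prev : v \notin supp (a (n - 1)) by rewrite v_new //; lia.
have [a_ew _] := ha.
have /fset0Pn[b] : supp (a n) `&` supp (a (n - 1)) != fset0.
  by apply/eqP/ew_meet.
rewrite inE => /andP[bn b_prev].
have neq_bv : b != v by apply: contraNneq v_prev => <-.
have suppY := supp_pair neq_bv.
suff -> : a n = 2 ^ b + 2 ^ v by rewrite /s2 suppY cardfs2 neq_bv.
apply/eqP; rewrite eqn_leq supp_pair_leq // andbT.
apply: (binary_enots_wolley_leq (c := v)) => //; rewrite ?suppY.
(* The candidate is new because no earlier term contains [v]. *)
- by move=> m /v_new; apply: contraNnot => ->; rewrite suppY !inE eqxx orbT.
- by move=> _; apply: (@fsetI_neq0 _ _ b); rewrite ?in_fset2 ?eqxx.
(* Both [b] and [v] lie in [supp (a n)], so disjointness from [a (n - 2)] is inherited. *)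
- move=> n_gt2; have disj := ew_disjoint a_ew n_gt2.
  apply: fsetI_eq0 => x; rewrite in_fset2 => xY x_prev.
  have := in_fset0 x; rewrite -disj in_fsetI x_prev andbT.
  by case/orP: xY => /eqP ->; rewrite ?bn ?hvn.
- by rewrite !inE eqxx orbT.
Qed.
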